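(* Let $\alpha:I\to\mathbb{I}_{\mathrm p}^3$ be an admissible unit speed curve in pseudo-isotropic space, with Frenet frame $\{\mathbf t,\mathbf n,\mathbf b\}$, curvature $\kappa$, torsion $\tau$, and signs $\epsilon=\langle\mathbf t,\mathbf t\rangle_{z,\mathrm p}$, $\eta=\langle\mathbf n,\mathbf n\rangle_{z,\mathrm p}=-\epsilon$, and fix $s_0\in I$. Let $\mathbf n_1$ be a unit normal vector field along $\alpha$. If $\mathbf n_1$ is rotation minimizing (RM), then $$\mathbf n_1(s)=\mathbf n(s)-\left(\int_{s_0}^s\tau(x)\,\mathrm dx+\tau_0\right)\mathbf b(s),$$ where $\tau_0$ is a constant. In addition, an RM frame $\{\mathbf t,\mathbf n_1,\mathbf n_2=\mathbf b\}$ in pseudo-isotropic space $\mathbb{I}_{\mathrm p}^3$ satisfies $$\frac{\mathrm d}{\mathrm ds}\begin{pmatrix}\mathbf t\\ \mathbf n_1\\ \mathbf n_2\end{pmatrix}=\begin{pmatrix}0&\eta\kappa_1&\kappa_2\\-\epsilon\kappa_1&0&0\\0&0&0\end{pmatrix}\begin{pmatrix}\mathbf t\\ \mathbf n_1\\ \mathbf n_2\end{pmatrix},$$ where the natural curvatures are $\kappa_1=\kappa=\kappa\,\mathrm{cosg}\,\theta$ and $\kappa_2=\eta\,\kappa\,\theta=-\epsilon\,\kappa\,\mathrm{sing}\,\theta$, with $\mathrm{sing}[\theta(s)]=\theta(s)=\int_{s_0}^s\tau(x)\,\mathrm dx+\tau_0$.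
   Context: Pseudo-isotropic space $\mathbb{I}_{\mathrm p}^3$ is $\mathbb{R}^3$ with the degenerate metric $\langle\mathbf u,\mathbf v\rangle_{z,\mathrm p}=u_1v_1-u_2v_2$ and $\Vert\mathbf v\Vert_{z,\mathrm p}=\sqrt{|\langle\mathbf v,\mathbf v\rangle_{z,\mathrm p}|}$. A regular curve $\alpha=(x,y,z):I\to\mathbb{I}_{\mathrm p}^3$ on an interval $I$ is admissible if it has no inflection point ($\alpha',\alpha''$ are linearly independent everywhere) and $x'y''-x''y'\neq0$ everywhere. Only spacelike curves ($\langle\alpha',\alpha'\rangle_{z,\mathrm p}>0$ everywhere) or timelike curves ($\langle\alpha',\alpha'\rangle_{z,\mathrm p}<0$ everywhere) are considered. Unit speed means $\langle\alpha',\alpha'\rangle_{z,\mathrm p}=\epsilon$ with $\epsilon\in\{-1,+1\}$ constant. Curves are assumed differentiable enough for all derivatives written to exist and be continuous. Frenet frame: $\mathbf t=\alpha'$, $\epsilon=\langle\mathbf t,\mathbf t\rangle_{z,\mathrm p}$, $\eta=-\epsilon$, $\kappa=\eta\Vert\alpha''\Vert_{z,\mathrm p}$ (nonzero), $\mathbf n=\mathbf t'/(\eta\kappa)$ (so that $\langle\mathbf n,\mathbf n\rangle_{z,\mathrm p}=\eta$), $\mathbf b=(0,0,1)$. It satisfies $\mathbf t'=-\epsilon\kappa\mathbf n$, $\mathbf n'=-\epsilon\kappa\mathbf t+\tau\mathbf b$, $\mathbf b'=0$, where the second equation defines the torsion $\tau$. A vector field $\mathbf v$ along $\alpha$ is normal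 if $\langle\mathbf v,\mathbf t\rangle_{z,\mathrm p}=0$ and unit if $\Vert\mathbf v\Vert_{z,\mathrm p}=1$. A normal vector field $\mathbf v$ is rotation minimizing (RM) if $\mathbf v'=\mu\,\mathbf t$ for some function $\mu$. An RM frame is a frame $\{\mathbf t,\mathbf n_1,\mathbf n_2=\mathbf b\}$ with $\mathbf n_1$ a unit RM normal field as in the claim. Galilean trigonometric functions: $\mathrm{cosg}\,\phi=1$, $\mathrm{sing}\,\phi=\phi$.
   Formalization: The formula for n_1 holds only up to a constant sign σ=±1 (−n_1 is also unit RM), so it is proved as n_1=σ(n−θb) with κ_1=σκ and κ_2=ηκθ; σ=1, the printed case, is proved when {t,n_1,b} and {t,n,b} have the same orientation at some point. *)

(* Defs.v *)
From HB Require Import structures.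
From mathcomp Require Import all_boot all_order all_algebra.
From mathcomp Require Import all_classical all_reals all_analysis.

Set Implicit Arguments.
Unset Strict Implicit.
Unset Printing Implicit Defensive.

Import Order.TTheory GRing.Theory Num.Theory.
Import numFieldNormedType.Exports.

Local Open Scope classical_set_scope.
Local Open Scope ring_scope.

(* Derivatives are taken relative to a set I, so that an interval may contain
   its endpoints (where the derivative is one-sided).  In the interior of I
   these are the ordinary derivatives. *)
Section DerivativeOn.
Context {R : realType} {V : normedModType R}.
Implicit Types (I : set R) (f : R -> V) (s : R).

Definition diff_quot f s : R -> V := fun x => (x - s)^-1 *: (f x - f s).

Definition derivable_on I f :=
  forall s, I s -> cvg (diff_quot f s x @[x --> within I s^']).

Definition derive_on I f : R -> V :=
  fun s => lim (diff_quot f s x @[x --> within I s^']).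

Definition C3_on I f :=
  [/\ derivable_on I f,
      derivable_on I (derive_on I f),
      derivable_on I (derive_on I (derive_on I f)) &
      {within I, continuous (derive_on I (derive_on I (derive_on I f)))}].

End DerivativeOn.

Section OrientedIntegral.
Context {R : realType}.

(* The integral from a to b, with the usual sign change when b < a;
   [Rintegral] over `[a, b] would be 0 in that case. *)
Definition oriented_integral (f : R -> R) (a b : R) : R :=
  if a <= b then \int[lebesgue_measure]_(x in `[a, b]) f x
  else - \int[lebesgue_measure]_(x in `[b, a]) f x.

End OrientedIntegral.

Section PseudoIsotropic.
Context {R : realType}.
Implicit Types (u v : 'rV[R]_3) (I : set R) (alpha : R -> 'rV[R]_3) (eps : R).

Definition pform u v : R := u 0 0 * v 0 0 - u 0 1 * v 0 1.

Definition pnorm v : R := Num.sqrt `|pform v v|.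

Definition e3 : 'rV[R]_3 := delta_mx 0 2.

Definition regular I alpha := forall s, I s -> derive_on I alpha s != 0.

Definition inflection_free I alpha := forall s, I s ->
  row_free (col_mx (derive_on I alpha s) (derive_on I (derive_on I alpha) s)).

Definition admissible I alpha :=
  [/\ regular I alpha, inflection_free I alpha &
      forall s, I s ->
        let d1 := derive_on I alpha s in
        let d2 := derive_on I (derive_on I alpha) s in
        d1 0 0 * d2 0 1 - d2 0 0 * d1 0 1 != 0].

(* A unit speed curve is spacelike if eps = 1 and timelike if eps = -1. *)
Definition unit_speed I alpha eps :=
  (eps = 1 \/ eps = -1) /\
  forall s, I s -> pform (derive_on I alpha s) (derive_on I alpha s) = eps.

Section Frenet.
Variables (I : set R) (alpha : R -> 'rV[R]_3) (eps : R).

Definition tangent : R -> 'rV[R]_3 := derive_on I alpha.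

Definition normal_sign : R := - eps.

Definition curvature : R -> R :=
  fun s => normal_sign * pnorm (derive_on I tangent s).

Definition normal : R -> 'rV[R]_3 :=
  fun s => (normal_sign * curvature s)^-1 *: derive_on I tangent s.

Definition binormal : R -> 'rV[R]_3 := fun=> e3.

(* The torsion is defined by n' = - eps * kappa * t + tau * b; since
   b = (0, 0, 1), it is the third coordinate of n' + eps * kappa * t, whose
   first two coordinates vanish for an admissible unit speed curve. *)
Definition torsion : R -> R :=
  fun s => (derive_on I normal s + (eps * curvature s) *: tangent s) 0 2.

(* The fields below are fields along alpha : I -> R^3; their values outside I
   are irrelevant. *)
Implicit Type w : R -> 'rV[R]_3.

Definition normal_field w := forall s, I s -> pform (w s) (tangent s) = 0.

Definition unit_field w := forall s, I s -> pnorm (w s) = 1.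

Definition rotation_minimizing w :=
  [/\ normal_field w, derivable_on I w &
      exists mu : R -> R,
        forall s, I s -> derive_on I w s = mu s *: tangent s].

End Frenet.

Definition mx3 (rows : seq (seq R)) : 'M[R]_3 :=
  \matrix_(i, j) (nth [::] rows i)`_j.

(* The matrix whose rows are the three vectors of the frame. *)
Definition frame_mx (w0 w1 w2 : R -> 'rV[R]_3) : R -> 'M[R]_3 :=
  fun s => \matrix_(i < 3) ([:: w0 s; w1 s; w2 s]`_i).

Definition same_orientation (A B : 'M[R]_3) := 0 < \det A * \det B.

Definition cosg (phi : R) : R := 1.
Definition sing (phi : R) : R := phi.

End PseudoIsotropic.

(* Main.v *)
Require Import Defs.
From mathcomp Require Import all_boot all_order all_algebra.
From mathcomp Require Import all_classical all_reals all_analysis.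
From mathcomp Require Import ring lra.

Import Order.TTheory GRing.Theory Num.Theory.
Import numFieldNormedType.Exports.

Local Open Scope classical_set_scope.
Local Open Scope ring_scope.

(** Only the top view of the picture, the projection to the Lorentz plane of
    the first two coordinates, carries metric information.  There the vectors
    orthogonal to a non-null vector (t0, t1) are the multiples of (t1, t0), and
    [wedge t u] is the coefficient ([normal_coord0], [normal_coord1]).  Hence
    the top views of the principal normal n and of a unit normal field n1 can
    differ only by a sign.  This sign, [relative_sign], is differentiable with
    square 1, so its derivative vanishes and it is constant along the interval
    ([derivable_sqr1_constant], [relative_sign_constant]).

    What is left is the third coordinate.  Put sigma for the sign and
    theta = n_3 - sigma n1_3 ([RM_angle]); by construction
    n1 = sigma (n - theta b).  If n1' = mu t, differentiating <n1, t> = 0 shows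
    that mu is sigma times the Lorentz norm |t'| ([has_derive_on_RM]); since
    torsion is defined by n' = |t'| t + tau b, subtracting the third
    coordinates gives theta' = tau ([has_derive_on_RM_angle]).  The torsion of a
    curve of class C^3 is continuous ([torsion_continuous]), so the fundamental
    theorem of calculus turns theta' = tau into the integral formula.  Finally
    t' = |t'| n = |t'| (sigma n1 + theta b) and n1' = sigma |t'| t are the rows
    of the moving frame equation ([has_derive_on_RM_frame]).

    Derivatives are limits of difference quotients relative to the interval,
    one-sided at its endpoints; the calculus of these is developed first.  At
    interior points they are ordinary derivatives, and continuity takes care
    of the endpoints in the fundamental theorem ([oriented_FTC]). *)

Set Implicit Arguments.
Unset Strict Implicit.
Unset Printing Implicit Defensive.

(** * Derivatives relative to a set *)

(** Relational companion of [derive_on]: naming the value of the limit lets the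
    rules of calculus be stated without a derivability side condition and
    without knowing that the filter is proper. *)
Definition has_derive_on {R : realType} {V : normedModType R} (I : set R)
    (f : R -> V) (s : R) (l : V) : Prop :=
  diff_quot f s x @[x --> within I s^'] --> l.

Section RelativeFilter.
Context {R : realType} (I : set R).
Hypotheses (I_itv : is_interval I) (I_nondeg : I° !=set0).

Lemma interval_other_point s : exists2 p, I p & p != s.
Proof.
have [c Ic] : exists c : R, I° c := I_nondeg.
have [->|cs] := eqVneq s c; last first.
  by exists c; [exact: interior_subset|rewrite eq_sym].
have near_c : \forall x \near c^', I x /\ x != c.
  rewrite /dnbhs near_withinE; apply: filterS Ic => x Ix xc.
  by split.
by have [p [Ip pc]] := @filter_ex _ c^' _ _ near_c; exists p.
Qed.

(** Every point of a nondegenerate interval is an accumulation point of it: it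
    is approached along the segment towards any other point.  This makes limits,
    hence derivatives, unique. *)
Lemma within_dnbhs_proper s : I s -> ProperFilter (within I s^').
Proof.
move=> Is; have [p Ip ps] := interval_other_point s.
apply: Build_ProperFilter_ex => A Anear0.
have Anear : \forall y \near s, y != s -> I y -> A y by exact: Anear0.
have psN0 : p - s != 0 by rewrite subr_eq0.
have : \forall u \near (0 : R)^'+, I (s + u * (p - s)) -> A (s + u * (p - s)).
  have cvgs : s + u * (p - s) @[u --> (0 : R)^'+] --> s.
    rewrite -[X in _ --> X]addr0 -[X in _ --> _ + X](mul0r (p - s)).
    apply: cvgD; first exact: cvg_cst.
    apply: cvgM; last exact: cvg_cst.
    by apply: cvg_at_right_filter; exact: cvg_id.
  have Au : \forall u \near (0 : R)^'+, s + u * (p - s) != s ->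
    I (s + u * (p - s)) -> A (s + u * (p - s)) by exact: cvgs _ Anear.
  near=> u; have u0 : 0 < u by [].
  apply: (near Au u) => //.
  by rewrite -subr_eq0 addrAC subrr add0r mulf_neq0// gt_eqF.
move=> Au; near (0 : R)^'+ => u.
have u0 : 0 < u by [].
have u1 : u < 1 by near: u; exact: nbhs_right_lt.
exists (s + u * (p - s)); apply: (near Au u) => //.
have [psp|psm] := ltP s p.
  apply: (I_itv Is Ip); apply/andP; split; nra.
by apply: (I_itv Ip Is); apply/andP; split; nra.
Unshelve. all: by end_near. Qed.
End RelativeFilter.

Section MatrixLimits.
Context {R : realType} {m n : nat}.

(** Convergence of matrices is entrywise because there are finitely many
    entries; all vector calculus below is reduced to scalar functions by it. *)
Lemma cvg_mxP (T : Type) (F : set_system T) (f : T -> 'M[R]_(m, n))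
    (M : 'M[R]_(m, n)) :
  Filter F ->
  (f x @[x --> F] --> M) <-> (forall i j, f x i j @[x --> F] --> M i j).
Proof.
move=> FF; split => [fM i j|fM].
  exact: (@cvg_comp _ _ _ f (fun N : 'M[R]_(m, n) => N i j) _ _ _ fM
    (@coord_continuous R m n i j M)).
apply/cvg_ballP => e e0.
near=> x; split => //.
near: x; apply: filter_forall => i; apply: filter_forall => j.
by move/cvg_ballP : (fM i j); exact.
Unshelve. all: by end_near. Qed.
End MatrixLimits.

Section Calculus.
Context {R : realType} (I : set R).
Implicit Types (f g : R -> R) (a s k l : R).

Lemma has_derive_on_continuous (V : normedModType R) (f : R -> V) s (l : V) :
  has_derive_on I f s l -> f x @[x --> within I (nbhs s)] --> f s.
Proof.
move=> fl.
have xs : x - s @[x --> within I s^'] --> (0 : R).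
  rewrite -(subrr s); apply: cvgB; last exact: cvg_cst.
  apply: cvg_within_filter; apply: cvg_within_filter; exact: cvg_id.
(* Away from s, f is recovered from its difference quotient. *)
have lim : (x - s) *: diff_quot f s x + f s @[x --> within I s^'] --> f s.
  rewrite -[X in _ --> X]add0r -[X in _ --> X + _](scale0r l).
  by apply: cvgD; [exact: cvgZ|exact: cvg_cst].
move=> U Us.
have H : \forall x \near s, x != s -> I x ->
  U ((x - s) *: diff_quot f s x + f s) by exact: lim _ Us.
suff : \forall x \near s, I x -> U (f x) by [].
near=> x => Ix.
have [->|xNs] := eqVneq x s; first exact: nbhs_singleton.
have := near H x _ xNs Ix.
rewrite /diff_quot scalerA divff ?subr_eq0// scale1r subrK; exact.
Unshelve. all: by end_near. Qed.

Lemma has_derive_on_continuous_dnbhs (V : normedModType R) (f : R -> V) s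
    (l : V) :
  has_derive_on I f s l -> f x @[x --> within I s^'] --> f s.
Proof.
move=> /has_derive_on_continuous fs; apply: cvg_trans fs.
apply: cvg_fmap2 => A IA.
have H : \forall x \near s, I x -> A x by exact: IA.
suff : \forall x \near s, x != s -> I x -> A x by [].
by apply: filterS H => x + _.
Qed.

Lemma has_derive_on_eq (V : normedModType R) (f g : R -> V) s (l : V) :
  I s -> (forall x, I x -> f x = g x) ->
  has_derive_on I f s l -> has_derive_on I g s l.
Proof.
move=> Is fg; apply: cvg_trans; apply: near_eq_cvg.
by near do rewrite /diff_quot !fg//; exact: withinT.
Unshelve. all: by end_near. Qed.

Lemma has_derive_on_mxP m n (f : R -> 'M[R]_(m.+1, n.+1)) s
    (l : 'M[R]_(m.+1, n.+1)) :
  has_derive_on I f s l <->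
  forall i j, has_derive_on I (fun x => f x i j) s (l i j).
Proof.
have E i j : (fun x => diff_quot f s x i j) =
    diff_quot (fun x => f x i j) s.
  by apply/funext => x; rewrite /diff_quot !mxE.
rewrite /has_derive_on cvg_mxP.
by split=> fl i j; have := fl i j; rewrite ?E -?E.
Qed.

Lemma has_derive_on_cst (V : normedModType R) (a : V) s :
  has_derive_on I (fun=> a) s 0.
Proof.
rewrite /has_derive_on /diff_quot.
by under eq_fun do rewrite subrr scaler0; exact: cvg_cst.
Qed.

Lemma has_derive_onD f g s l k :
  has_derive_on I f s l -> has_derive_on I g s k ->
  has_derive_on I (fun x => f x + g x) s (l + k).
Proof.
move=> fl gk; have E : diff_quot (fun x => f x + g x) s =
    (fun x => diff_quot f s x + diff_quot g s x).
  by apply/funext => x; rewrite /diff_quot -scalerDr opprD addrACA.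
by rewrite /has_derive_on E; exact: cvgD.
Qed.

Lemma has_derive_onM f g s l k :
  has_derive_on I f s l -> has_derive_on I g s k ->
  has_derive_on I (fun x => f x * g x) s (l * g s + f s * k).
Proof.
move=> fl gk; have gs := has_derive_on_continuous_dnbhs gk.
have E : diff_quot (fun x => f x * g x) s =
    (fun x => diff_quot f s x * g x + f s * diff_quot g s x).
  by apply/funext => x; rewrite /diff_quot /GRing.scale /=; ring.
rewrite /has_derive_on E; apply: cvgD; first exact: cvgM.
by apply: cvgM => //; exact: cvg_cst.
Qed.

Lemma has_derive_onZ a f s l :
  has_derive_on I f s l -> has_derive_on I (fun x => a * f x) s (a * l).
Proof.
move=> fl; have := has_derive_onM (has_derive_on_cst a s) fl.
by rewrite mul0r add0r.
Qed.

Lemma has_derive_onB f g s l k :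
  has_derive_on I f s l -> has_derive_on I g s k ->
  has_derive_on I (fun x => f x - g x) s (l - k).
Proof.
move=> fl gk; have := has_derive_onD fl (has_derive_onZ (a := -1) gk).
rewrite mulN1r (_ : (fun x => f x + -1 * g x) = fun x => f x - g x)//.
by apply/funext => x; rewrite mulN1r.
Qed.

Lemma has_derive_onV f s l : f s != 0 -> has_derive_on I f s l ->
  has_derive_on I (fun x => (f x)^-1) s (- l / f s ^+ 2).
Proof.
move=> fs0 fl; have fs := has_derive_on_continuous_dnbhs fl.
have fx0 : \forall x \near within I s^', f x != 0.
  exact: (cvgr_neq0 _ fs).
have lim : - diff_quot f s x * (f x * f s)^-1 @[x --> within I s^'] -->
    - l / f s ^+ 2.
  apply: cvgM; first exact: cvgN.
  apply: cvgV; first by rewrite expf_neq0.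
  by rewrite expr2; apply: cvgM => //; exact: cvg_cst.
move: lim; apply: cvg_trans; apply: near_eq_cvg; near=> x.
have fx : f x != 0 by near: x.
rewrite /diff_quot /GRing.scale /= invfM.
have -> : (f x)^-1 - (f s)^-1 = (f s - f x) * ((f x)^-1 * (f s)^-1)
  by field; rewrite fx fs0.
by ring.
Unshelve. all: by end_near. Qed.

(** The sign of f is constant near s.  It is written `|f s| / f s, so that the
    derivative is visibly continuous when f is. *)
Lemma has_derive_on_norm f s l : f s != 0 -> has_derive_on I f s l ->
  has_derive_on I (fun x => `|f x|) s (`|f s| / f s * l).
Proof.
move=> fs0 fl; have fs := has_derive_on_continuous_dnbhs fl.
have E : `|f s| / f s = Num.sg (f s).
  by rewrite normrEsg -mulrA divff// mulr1.
have sgE : \forall x \near within I s^', `|f x| = Num.sg (f s) * f x.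
  have [fs_gt|fs_lt|/eqP] := ltrgtP (f s) 0; last by rewrite (negbTE fs0).
    near=> x; rewrite ltr0_sg// mulN1r ltr0_norm//; near: x.
    exact: cvgr_lt fs _ fs_gt.
  near=> x; rewrite gtr0_sg// mul1r gtr0_norm//; near: x.
  exact: cvgr_gt fs _ fs_lt.
rewrite E; have := has_derive_onZ (a := Num.sg (f s)) fl.
apply: cvg_trans; apply: near_eq_cvg; near=> x.
by rewrite /diff_quot (near sgE x)// [`|f s|]normrEsg.
Unshelve. all: by end_near. Qed.

End Calculus.

(** * Calculus on an interval *)

Section Interval.
Context {R : realType} (I : set R).
Hypotheses (I_itv : is_interval I) (I_nondeg : I° !=set0).

Lemma has_derive_onE (V : normedModType R) (f : R -> V) s (l : V) :
  I s -> has_derive_on I f s l -> derive_on I f s = l.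
Proof.
move=> Is fl; have FF := within_dnbhs_proper I_itv I_nondeg Is.
exact: (cvg_lim _ fl).
Qed.

Lemma derivable_onP (V : normedModType R) (f : R -> V) s :
  derivable_on I f -> I s -> has_derive_on I f s (derive_on I f s).
Proof. by move=> df Is; exact: df. Qed.

Lemma has_derive_on_unique (f : R -> R) (s l k : R) :
  I s -> has_derive_on I f s l -> has_derive_on I f s k -> l = k.
Proof. by move=> Is /(has_derive_onE Is) <- /(has_derive_onE Is) <-. Qed.

(** The set J serves to localize: below it is an open subinterval, whose
    interior is explicit, whereas that of I is not. *)
Lemma has_derive_on_interior (f : R -> R) (s l : R) (J : set R) :
  J `<=` I -> J° s -> has_derive_on I f s l -> is_derive s 1 f l.
Proof.
move=> JI Js fl.
have Is : \forall x \near s, I x.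
  by apply: filterS Js => x; exact: JI.
have shift_cvg : h + s @[h --> (0 : R)^'] --> within I s^'.
  move=> A A_near.
  have : \forall x \near s, x != s -> I x -> A x by exact: A_near.
  move=> /nbhs0P A0.
  have I0 : \forall h \near 0, I (s + h).
    by move/nbhs0P : Is.
  suff : \forall h \near 0, h != 0 -> A (h + s) by [].
  near=> h => h0.
  rewrite addrC; apply: (near A0 h) => //; last exact: (near I0 h).
  by rewrite -subr_eq0 addrAC subrr add0r.
have lim : h^-1 *: ((f \o shift s) (h *: (1 : R)) - f s)
    @[h --> (0 : R)^'] --> l.
  have := @cvg_comp _ _ _ (+%R^~ s) (diff_quot f s) _ _ _ shift_cvg fl.
  rewrite (_ : diff_quot f s \o _ = fun h : R =>
     h^-1 *: ((f \o shift s) (h *: (1 : R)) - f s))//.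
  by apply/funext => h; rewrite /diff_quot /= addrK [_ *: 1]mulr1.
split; first by apply/cvg_ex; exists l.
exact: (cvg_lim _ lim).
Unshelve. all: by end_near. Qed.

Lemma FTC_on_segment (F f : R -> R) a b :
  I a -> I b -> a <= b ->
  (forall s, I s -> has_derive_on I F s (f s)) ->
  {within I, continuous f} ->
  \int[lebesgue_measure]_(x in `[a, b]) f x = F b - F a.
Proof.
move=> Ia Ib; rewrite le_eqVlt => /orP[/eqP <- _ _|ab dF cf].
  by rewrite set_itv1 Rintegral_set1 subrr.
have abI : `[a, b]%classic `<=` I.
  by move=> x; rewrite /= in_itv /=; exact: (I_itv Ia Ib).
have dF_oo x : x \in `]a, b[ -> is_derive x 1 F (f x).
  move=> xab; apply: (@has_derive_on_interior F x (f x) `]a, b[%classic).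
  - by move=> y /subset_itv_oo_cc; exact: abI.
  - by rewrite interior_itv; exact: xab.
  - by apply/dF/abI; exact: subset_itv_oo_cc xab.
have cF : {within `[a, b], continuous F}.
  apply: (continuous_subspaceW abI); apply/subspace_continuousP => x Ix.
  exact: has_derive_on_continuous (dF x Ix).
have [_ Fa Fb] := (continuous_within_itvP F ab).1 cF.
rewrite /Rintegral (@continuous_FTC2 R f F a b ab) //.
- exact: continuous_subspaceW abI cf.
- by split => // x /dF_oo [].
- by move=> x /dF_oo [? <-]; rewrite derive1E.
Qed.

Lemma oriented_FTC (F f : R -> R) a b :
  I a -> I b ->
  (forall s, I s -> has_derive_on I F s (f s)) ->
  {within I, continuous f} ->
  oriented_integral f a b = F b - F a.
Proof.
move=> Ia Ib dF cf; rewrite /oriented_integral; case: leP => [ab|/ltW ba].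
  exact: FTC_on_segment.
by rewrite (FTC_on_segment Ib Ia ba dF cf) opprB.
Qed.

Lemma has_derive_on0_constant (F : R -> R) a b :
  I a -> I b -> (forall s, I s -> has_derive_on I F s 0) -> F b = F a.
Proof.
move=> Ia Ib dF; apply/eqP; rewrite -subr_eq0.
rewrite -(oriented_FTC Ia Ib (f := fun=> 0))//; last first.
  by apply: continuous_subspaceT => x; exact: cvg_cst.
by rewrite /oriented_integral /Rintegral !integral0 oppr0 if_same.
Qed.

(** A differentiable sign is constant, since F F' = 0 and F does not vanish. *)
Lemma derivable_sqr1_constant (F : R -> R) a b :
  I a -> I b -> (forall s, I s -> exists l, has_derive_on I F s l) ->
  (forall s, I s -> F s ^+ 2 = 1) -> F b = F a.
Proof.
move=> Ia Ib dF F1; apply: has_derive_on0_constant => // s Is.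
have [l Fl] := dF s Is.
have F2 : has_derive_on I (fun x => F x * F x) s 0.
  apply: (has_derive_on_eq Is _ (has_derive_on_cst I (1 : R) s)) => x Ix.
  by rewrite -expr2 F1.
have /eqP := has_derive_on_unique Is F2 (has_derive_onM Fl Fl).
rewrite eq_sym mulrC -mulr2n mulrn_eq0/= mulf_eq0.
have [Fs0|_ /= /eqP <-//] := eqVneq (F s) 0.
by have := F1 s Is; rewrite Fs0 expr0n/= => /eqP; rewrite eq_sym oner_eq0.
Qed.

End Interval.

(** * The Lorentz plane of the first two coordinates *)

Section LorentzPlane.
Context {R : realType}.
Implicit Types t u v : 'rV[R]_3.

(** The signed area spanned by the top views of u and v; completed by
    the binormal, u and v form a frame with this determinant
    ([det_frame_mx]). *)
Definition wedge u v : R := u 0 0 * v 0 1 - u 0 1 * v 0 0.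

(* Entries of compound rows, for rows that are variables: applied to the fields
   along a curve, they do not unfold the limits which define these. *)
Lemma row_scaleE (x : R) u i : (x *: u) 0 i = x * u 0 i.
Proof. by rewrite mxE. Qed.

Lemma row_addE u v i : (u + v) 0 i = u 0 i + v 0 i.
Proof. by rewrite mxE. Qed.

Lemma row_sub_binormalE u x s i :
  (u - x *: @binormal R s) 0 i = u 0 i - x * (i == 2)%:R.
Proof. by rewrite !mxE. Qed.

Lemma row_combE (x y : R) u v i : (x *: u + y *: v) 0 i = x * u 0 i + y * v 0 i.
Proof. by rewrite !mxE. Qed.

Lemma comb_factor (x y z : R) u v :
  (x * y) *: u + (y * z) *: v = y *: (x *: u + z *: v).
Proof. by rewrite scalerDr !scalerA mulrC. Qed.

Lemma wedgevv u : wedge u u = 0.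
Proof. by rewrite /wedge mulrC subrr. Qed.

Lemma wedgeZr x u v : wedge u (x *: v) = x * wedge u v.
Proof. by rewrite /wedge !row_scaleE; ring. Qed.

Lemma pformZl x u v : pform (x *: u) v = x * pform u v.
Proof. by rewrite /pform !row_scaleE; ring. Qed.

(** The Lorentzian Lagrange identity.  It turns the norm of a vector orthogonal
    to t into the area [wedge t u]. *)
Lemma pform_wedge t u :
  pform t t * pform u u = pform u t ^+ 2 - wedge t u ^+ 2.
Proof. by rewrite /pform /wedge; ring. Qed.

(** The top view of a vector orthogonal to t is a multiple of (t_1, t_0), the
    mirror image of that of t in the light cone. *)
Lemma normal_coord0 t u :
  pform u t = 0 -> pform t t * u 0 0 = wedge t u * t 0 1.
Proof.
move=> ut; have : pform u t * t 0 0 = 0 by rewrite ut mul0r.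
by rewrite /pform /wedge; lra.
Qed.

Lemma normal_coord1 t u :
  pform u t = 0 -> pform t t * u 0 1 = wedge t u * t 0 0.
Proof.
move=> ut; have : pform u t * t 0 1 = 0 by rewrite ut mul0r.
by rewrite /pform /wedge; lra.
Qed.

(** Orthogonality to a non-null t cuts out a line in the Lorentz plane. *)
Lemma normal_collinear t u v i :
  pform t t != 0 -> pform u t = 0 -> pform v t = 0 -> i = 0 \/ i = 1 ->
  wedge t u * v 0 i = wedge t v * u 0 i.
Proof.
move=> tt ut vt i01; apply: (mulfI tt).
rewrite mulrCA [RHS]mulrCA; case: i01 => ->.
  by rewrite !normal_coord0// mulrCA.
by rewrite !normal_coord1// mulrCA.
Qed.

Lemma pform_normal_wedge t u v :
  pform u t = 0 -> pform t t * pform u v = - (wedge t u * wedge t v).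
Proof.
move=> ut; have := normal_coord0 ut; have := normal_coord1 ut.
rewrite [pform u v]/pform mulrBr !mulrA => -> ->.
by rewrite /wedge; ring.
Qed.

Lemma cvg_wedge (T : Type) (F : set_system T) (u v : T -> 'rV[R]_3)
    (u0 v0 : 'rV[R]_3) :
  Filter F ->
  (forall i, u x 0 i @[x --> F] --> u0 0 i) ->
  (forall i, v x 0 i @[x --> F] --> v0 0 i) ->
  wedge (u x) (v x) @[x --> F] --> wedge u0 v0.
Proof. by move=> FF uu0 vv0; apply: cvgB; apply: cvgM. Qed.

(** Derivative of a / |wedge t a| along a curve with tangent t, acceleration a
    and jerk j; the derivative of wedge t a is wedge t j. *)
Definition normal_rate t a j : 'rV[R]_3 :=
  - (`|wedge t a| / wedge t a * wedge t j) / `|wedge t a| ^+ 2 *: a +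
  `|wedge t a|^-1 *: j.

(** The torsion as an explicit function of the first three derivatives of the
    curve, from which its continuity can be read off. *)
Definition torsion_at t a j : R :=
  normal_rate t a j 0 2 - `|wedge t a| * t 0 2.

Lemma cvg_torsion_at (T : Type) (F : set_system T) (t a j : T -> 'rV[R]_3)
    (t0 a0 j0 : 'rV[R]_3) :
  Filter F -> wedge t0 a0 != 0 ->
  (forall i, t x 0 i @[x --> F] --> t0 0 i) ->
  (forall i, a x 0 i @[x --> F] --> a0 0 i) ->
  (forall i, j x 0 i @[x --> F] --> j0 0 i) ->
  torsion_at (t x) (a x) (j x) @[x --> F] --> torsion_at t0 a0 j0.
Proof.
move=> FF w0 ct ca cj.
have cw := cvg_wedge FF ct ca.
have cn : `|wedge (t x) (a x)| @[x --> F] --> `|wedge t0 a0| by apply: cvg_norm.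
have n0 : `|wedge t0 a0| != 0 by rewrite normr_eq0.
rewrite /torsion_at /normal_rate row_combE expr2.
under eq_fun do rewrite row_combE expr2.
apply: cvgB; last exact: cvgM.
apply: cvgD; apply: cvgM => //; last exact: cvgV.
apply: cvgM; last by apply: cvgV; [rewrite mulf_neq0|exact: cvgM].
apply: cvgN; apply: cvgM; last exact: cvg_wedge.
by apply: cvgM => //; exact: cvgV.
Qed.

Lemma det_mx3 (A : 'M[R]_3) :
  \det A = A 0 0 * (A 1 1 * A 2 2 - A 1 2 * A 2 1)
         - A 0 1 * (A 1 0 * A 2 2 - A 1 2 * A 2 0)
         + A 0 2 * (A 1 0 * A 2 1 - A 1 1 * A 2 0).
Proof.
(* Entries indexed by natural numbers, so that the ordinals made by the two
   nested expansions compare by computation. *)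
pose E (i j : nat) := A (inord i) (inord j).
have AE i j : A i j = E i j by rewrite /E !inord_val.
rewrite (expand_det_row _ 0) !big_ord_recl big_ord0 /cofactor.
rewrite !(expand_det_row _ 0) !big_ord_recl !big_ord0 /cofactor.
rewrite !det_mx11 !mxE !AE /= /bump /=.
rewrite !addr0 !expr0 !expr1 !expr2.
by ring.
Qed.

Lemma det_frame_mx (w0 w1 : R -> 'rV[R]_3) s :
  \det (frame_mx w0 w1 (@binormal R) s) = wedge (w0 s) (w1 s).
Proof.
rewrite det_mx3 /frame_mx !mxE /= /wedge /binormal /e3 ?mxE/=.
by ring.
Qed.

Lemma pnorm1_wedge t u : `|pform t t| = 1 -> pform u t = 0 ->
  pnorm u = 1 -> wedge t u ^+ 2 = 1.
Proof.
move=> tt ut u1.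
have uu : `|pform u u| = 1.
  by rewrite -[LHS]sqr_sqrtr// -/(pnorm u) u1 expr1n.
have := pform_wedge t u; rewrite ut expr0n/= sub0r => /(congr1 Num.norm).
by rewrite normrM tt uu mulr1 normrN normrX real_normK ?num_real.
Qed.

Lemma row3P u v :
  u 0 0 = v 0 0 -> u 0 1 = v 0 1 -> u 0 2 = v 0 2 -> u = v.
Proof.
move=> e0 e1 e2; apply/rowP => -[[|[|[|//]]] lti].
- by rewrite (_ : Ordinal lti = 0)//; apply/val_inj.
- by rewrite (_ : Ordinal lti = 1)//; apply/val_inj.
- by rewrite (_ : Ordinal lti = 2)//; apply/val_inj.
Qed.

Lemma has_derive_on_frame_mx (I : set R) (w0 w1 w2 : R -> 'rV[R]_3)
    (l0 l1 l2 : 'rV[R]_3) s :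
  has_derive_on I w0 s l0 -> has_derive_on I w1 s l1 ->
  has_derive_on I w2 s l2 ->
  has_derive_on I (frame_mx w0 w1 w2) s (\matrix_(i < 3) [:: l0; l1; l2]`_i).
Proof.
move=> /has_derive_on_mxP d0 /has_derive_on_mxP d1 /has_derive_on_mxP d2.
apply/has_derive_on_mxP => i j; rewrite mxE.
have -> : (fun x => frame_mx w0 w1 w2 x i j) =
    fun x => [:: w0 x; w1 x; w2 x]`_i 0 j by apply/funext => x; rewrite mxE.
by case: i => -[|[|[|//]]].
Qed.

Lemma mulmx_frame_mx (p q r : R) (w0 w1 w2 : R -> 'rV[R]_3) s :
  mx3 [:: [:: 0; p; q]; [:: r; 0; 0]; [:: 0; 0; 0]] *m frame_mx w0 w1 w2 s =
  \matrix_(i < 3) [:: p *: w1 s + q *: w2 s; r *: w0 s; 0]`_i.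
Proof.
apply/matrixP => i j; rewrite [LHS]mxE !big_ord_recl big_ord0.
by case: i => -[|[|[|//]]] lti /=; rewrite !mxE/=; ring.
Qed.
End LorentzPlane.

(** * The Frenet frame *)

Section Curve.
Context {R : realType} (I : set R) (alpha : R -> 'rV[R]_3) (eps : R).
Hypotheses (I_itv : is_interval I) (I_nondeg : I° !=set0).
Hypotheses (alpha_C3 : C3_on I alpha) (alpha_adm : admissible I alpha).
Hypothesis alpha_unit : unit_speed I alpha eps.

Let t := tangent I alpha.
Let a := derive_on I t.
Let j := derive_on I a.
Let n := normal I alpha eps.

Lemma eps_sqr : eps * eps = 1.
Proof. by have [[->|->] _] := alpha_unit; rewrite ?mulr1 ?mulrNN ?mulr1. Qed.

Lemma abs_eps : `|eps| = 1.
Proof. by have [[->|->] _] := alpha_unit; rewrite ?normrN normr1. Qed.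

Lemma tangent_pform s : I s -> pform (t s) (t s) = eps.
Proof. by move=> Is; exact: alpha_unit.2. Qed.

Lemma has_derive_on_tangent s i :
  I s -> has_derive_on I (fun x => t x 0 i) s (a s 0 i).
Proof.
move=> Is; have [_ dt _ _] := alpha_C3.
by move/has_derive_on_mxP : (derivable_onP dt Is) => /(_ 0 i).
Qed.

Lemma has_derive_on_acceleration s i :
  I s -> has_derive_on I (fun x => a x 0 i) s (j s 0 i).
Proof.
move=> Is; have [_ _ da _] := alpha_C3.
by move/has_derive_on_mxP : (derivable_onP da Is) => /(_ 0 i).
Qed.

Lemma jerk_continuous s i : I s ->
  j x 0 i @[x --> within I (nbhs s)] --> j s 0 i.
Proof.
move=> Is; have [_ _ _ /subspace_continuousP cj] := alpha_C3.
by move/cvg_mxP : (cj s Is) => /(_ 0 i).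
Qed.

Lemma has_derive_on_pform (u v : R -> 'rV[R]_3) (u' v' : 'rV[R]_3) s :
  (forall i, has_derive_on I (fun x => u x 0 i) s (u' 0 i)) ->
  (forall i, has_derive_on I (fun x => v x 0 i) s (v' 0 i)) ->
  has_derive_on I (fun x => pform (u x) (v x)) s
    (pform u' (v s) + pform (u s) v').
Proof.
move=> du dv.
have -> : pform u' (v s) + pform (u s) v' =
    (u' 0 0 * v s 0 0 + u s 0 0 * v' 0 0) -
    (u' 0 1 * v s 0 1 + u s 0 1 * v' 0 1) by rewrite /pform; ring.
by apply: has_derive_onB; apply: has_derive_onM.
Qed.

Lemma has_derive_on_wedge (u v : R -> 'rV[R]_3) (u' v' : 'rV[R]_3) s :
  (forall i, has_derive_on I (fun x => u x 0 i) s (u' 0 i)) ->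
  (forall i, has_derive_on I (fun x => v x 0 i) s (v' 0 i)) ->
  has_derive_on I (fun x => wedge (u x) (v x)) s
    (wedge u' (v s) + wedge (u s) v').
Proof.
move=> du dv.
have -> : wedge u' (v s) + wedge (u s) v' =
    (u' 0 0 * v s 0 1 + u s 0 0 * v' 0 1) -
    (u' 0 1 * v s 0 0 + u s 0 1 * v' 0 0) by rewrite /wedge; ring.
by apply: has_derive_onB; apply: has_derive_onM.
Qed.

(** Differentiate <t, t> = eps. *)
Lemma acceleration_normal s : I s -> pform (a s) (t s) = 0.
Proof.
move=> Is; have dtt := has_derive_on_pform
  (fun=> has_derive_on_tangent Is) (fun=> has_derive_on_tangent Is).
have ct : has_derive_on I (fun x => pform (t x) (t x)) s 0.
  apply: (has_derive_on_eq Is _ (has_derive_on_cst I eps s)) => x Ix.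
  by rewrite tangent_pform.
have := has_derive_on_unique I_itv I_nondeg Is dtt ct.
by rewrite /pform; lra.
Qed.

Let c s := wedge (t s) (a s).

Lemma area_speed_neq0 s : I s -> c s != 0.
Proof.
move=> Is; have [_ _ /(_ s Is) /=] := alpha_adm.
by rewrite /c /wedge [t s 0 1 * _]mulrC.
Qed.

(** By the Lagrange identity; so the curvature is never 0 and is as smooth as
    the area c, in spite of the square root which defines it. *)
Lemma acceleration_norm s : I s -> pnorm (a s) = `|c s|.
Proof.
move=> Is.
have := pform_wedge (t s) (a s).
rewrite tangent_pform // acceleration_normal // expr0n /= sub0r -/(c s) => E.
have aa : pform (a s) (a s) = - (eps * c s ^+ 2).
  by rewrite -mulrN -E mulrA eps_sqr mul1r.
by rewrite /pnorm aa normrN normrM abs_eps mul1r normrX sqrtr_sqr normr_id.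
Qed.

Lemma curvatureE s : I s -> curvature I alpha eps s = - eps * `|c s|.
Proof. by move=> Is; rewrite /curvature acceleration_norm. Qed.

Lemma normalE s : I s -> n s = `|c s|^-1 *: a s.
Proof.
move=> Is; rewrite /n /normal curvatureE // /normal_sign mulrA mulrNN eps_sqr.
by rewrite mul1r.
Qed.

Lemma has_derive_on_curvature s :
  I s -> has_derive_on I (fun x => `|c x|) s
    (`|c s| / c s * wedge (t s) (j s)).
Proof.
move=> Is; apply: has_derive_on_norm; first exact: area_speed_neq0.
rewrite -[wedge (t s) (j s)]add0r -(wedgevv (a s)).
apply: has_derive_on_wedge => i; first exact: has_derive_on_tangent.
exact: has_derive_on_acceleration.
Qed.

Lemma has_derive_on_normal s :
  I s -> has_derive_on I n s (normal_rate (t s) (a s) (j s)).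
Proof.
move=> Is; apply: (has_derive_on_eq Is (f := fun x => `|c x|^-1 *: a x)).
  by move=> x Ix; rewrite normalE.
apply/has_derive_on_mxP => i i'; rewrite ord1.
rewrite (_ : (fun x => _) = fun x => `|c x|^-1 * a x 0 i'); last first.
  by apply/funext => x; rewrite row_scaleE.
rewrite /normal_rate row_combE; apply: has_derive_onM;
  last exact: has_derive_on_acceleration.
apply: has_derive_onV; first by rewrite normr_eq0 area_speed_neq0.
exact: has_derive_on_curvature.
Qed.

Let tau := torsion I alpha eps.

Lemma torsionE s : I s -> tau s = torsion_at (t s) (a s) (j s).
Proof.
move=> Is; rewrite /tau /torsion.
rewrite (has_derive_onE I_itv I_nondeg Is (has_derive_on_normal Is)).
by rewrite curvatureE // mulrA mulrN eps_sqr mulN1r row_addE row_scaleE mulNr.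
Qed.

Lemma torsion_continuous : {within I, continuous tau}.
Proof.
apply: (@subspace_eq_continuous _ _ _ (fun s => torsion_at (t s) (a s) (j s))).
  by move=> s; rewrite inE => Is; symmetry; exact: torsionE.
apply/subspace_continuousP => s Is; apply: cvg_torsion_at => [|i|i|i].
- exact: area_speed_neq0.
- exact: has_derive_on_continuous (has_derive_on_tangent Is).
- exact: has_derive_on_continuous (has_derive_on_acceleration Is).
- exact: jerk_continuous.
Qed.

(** * Rotation minimizing fields *)

Variables (s0 : R) (n1 : R -> 'rV[R]_3).
Hypotheses (I_s0 : I s0) (n1_unit : unit_field I n1).
Hypothesis n1_RM : rotation_minimizing I alpha n1.

Let m s := wedge (t s) (n1 s).

(** Product of the determinants of the frames (t, n1, b) and (t, n, b). *)
Definition relative_sign s : R := m s * (c s / `|c s|).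

Lemma wedge_normal s : I s -> wedge (t s) (n s) = c s / `|c s|.
Proof.
by move=> Is; rewrite normalE // wedgeZr mulrC.
Qed.

Lemma sgn_area_sqr s : I s -> (c s / `|c s|) ^+ 2 = 1.
Proof.
move=> Is; have c0 := area_speed_neq0 Is.
by rewrite exprMn exprVn real_normK ?num_real// divff// expf_neq0.
Qed.

Lemma RM_wedge_sqr s : I s -> m s ^+ 2 = 1.
Proof.
move=> Is; apply: pnorm1_wedge; last exact: n1_unit.
  by rewrite tangent_pform // abs_eps.
by have [nt _ _] := n1_RM; exact: nt.
Qed.

Lemma relative_sign_sqr s : I s -> relative_sign s ^+ 2 = 1.
Proof. by move=> Is; rewrite exprMn RM_wedge_sqr// sgn_area_sqr// mulr1. Qed.

(** Differentiating <n1, t> = 0 gives mu eps = - <n1, t'>, and both n1 and t'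
    are orthogonal to t, so that eps <n1, t'> is minus the product of their
    areas with t. *)
Lemma has_derive_on_RM s :
  I s -> has_derive_on I n1 s ((m s * c s) *: t s).
Proof.
move=> Is; have [nt dn1 [mu muE]] := n1_RM.
have dn := derivable_onP dn1 Is; rewrite muE // in dn.
suff -> : m s * c s = mu s by [].
have dnc i : has_derive_on I (fun x => n1 x 0 i) s ((mu s *: t s) 0 i).
  by move/has_derive_on_mxP : dn => /(_ 0 i).
have dp := has_derive_on_pform dnc (fun=> has_derive_on_tangent Is).
have z : has_derive_on I (fun x => pform (n1 x) (t x)) s 0.
  apply: (has_derive_on_eq Is _ (has_derive_on_cst I (0 : R) s)) => x Ix.
  by symmetry; exact: nt.
have := has_derive_on_unique I_itv I_nondeg Is dp z.
have := pform_normal_wedge (a s) (nt s Is).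
rewrite -/(m s) -/(c s) -/(t s) tangent_pform// => pna.
rewrite pformZl tangent_pform//.
move=> /(congr1 ( *%R eps)); rewrite mulr0 mulrDr pna mulrCA eps_sqr mulr1.
by move=> /eqP; rewrite subr_eq0 => /eqP.
Qed.

Lemma relative_sign_constant s : I s -> relative_sign s = relative_sign s0.
Proof.
move=> Is; apply: (derivable_sqr1_constant I_itv I_nondeg I_s0 Is) => x Ix.
  have dnx := has_derive_on_RM Ix.
  have dnc i : has_derive_on I (fun x => n1 x 0 i) x (((m x * c x) *: t x) 0 i).
    by move/has_derive_on_mxP : dnx => /(_ 0 i).
  have dm := has_derive_on_wedge (fun=> has_derive_on_tangent Ix) dnc.
  have dc := has_derive_on_wedge (fun=> has_derive_on_tangent Ix)
    (fun=> has_derive_on_acceleration Ix).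
  have k0 : `|c x| != 0 by rewrite normr_eq0 area_speed_neq0.
  have dk := @has_derive_onV _ I (fun y => `|c y|) _ _ k0
    (has_derive_on_curvature Ix).
  eexists; exact: has_derive_onM dm (has_derive_onM dc dk).
exact: relative_sign_sqr.
Qed.

(** In the Lorentz plane n1 and n are unit vectors on the same line. *)
Lemma RM_coordinate s i : I s -> i = 0 \/ i = 1 ->
  n1 s 0 i = relative_sign s0 * n s 0 i.
Proof.
move=> Is i01; have [nt _ _] := n1_RM.
have nt0 : pform (n s) (t s) = 0.
  by rewrite normalE // pformZl acceleration_normal // mulr0.
have tt0 : pform (t s) (t s) != 0.
  by rewrite tangent_pform // -normr_eq0 abs_eps oner_neq0.
have := normal_collinear tt0 nt0 (nt s Is) i01.
rewrite wedge_normal // -/(m s) => /(congr1 ( *%R (c s / `|c s|))).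
rewrite mulrA -expr2 sgn_area_sqr // mul1r => ->.
by rewrite mulrA -(relative_sign_constant Is) [_ * m s]mulrC.
Qed.

(** The Galilean angle between n and n1: rotations of the normal plane that
    keep b are shears, so that the angle is a difference of heights. *)
Definition RM_angle s : R := n s 0 2 - relative_sign s0 * n1 s 0 2.

(** The tangential parts of n' and of sigma n1' are both |t'| t; only the
    binormal part tau of n' survives. *)
Lemma has_derive_on_RM_angle s : I s -> has_derive_on I RM_angle s (tau s).
Proof.
move=> Is; rewrite torsionE // /torsion_at; apply: has_derive_onB.
  by move/has_derive_on_mxP : (has_derive_on_normal Is) => /(_ 0 2).
have -> : `|wedge (t s) (a s)| * t s 0 2 =
    relative_sign s0 * ((m s * c s) *: t s) 0 2.
  rewrite row_scaleE mulrA -(relative_sign_constant Is); congr (_ * _).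
  have c0 : `|c s| != 0 by rewrite normr_eq0 area_speed_neq0.
  have -> : relative_sign s * (m s * c s) = m s ^+ 2 * (c s ^+ 2 / `|c s|).
    by rewrite /relative_sign; ring.
  by rewrite RM_wedge_sqr// mul1r -real_normK ?num_real// expr2 mulfK.
apply: has_derive_onZ.
by move/has_derive_on_mxP : (has_derive_on_RM Is) => /(_ 0 2).
Qed.

Lemma RM_angleE s :
  I s -> RM_angle s = oriented_integral tau s0 s + RM_angle s0.
Proof.
move=> Is; rewrite (oriented_FTC I_itv I_s0 Is has_derive_on_RM_angle) ?subrK//.
exact: torsion_continuous.
Qed.

Lemma RM_fieldE s :
  I s -> n1 s = relative_sign s0 *: (n s - RM_angle s *: binormal s).
Proof.
move=> Is.
apply: row3P; rewrite row_scaleE row_sub_binormalE.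
- by rewrite mulr0 subr0; apply: RM_coordinate => //; left.
- by rewrite mulr0 subr0; apply: RM_coordinate => //; right.
rewrite mulr1 opprB addrCA subrr addr0 mulrA -expr2 relative_sign_sqr//.
by rewrite mul1r.
Qed.

Lemma same_orientation_relative_sign s : I s ->
  same_orientation (frame_mx t n1 (@binormal R) s)
    (frame_mx t n (@binormal R) s) -> relative_sign s0 = 1.
Proof.
move=> Is; rewrite /same_orientation !det_frame_mx wedge_normal //.
rewrite -/(m s) -/(relative_sign s) (relative_sign_constant Is) => sgt0.
have /eqP := relative_sign_sqr I_s0.
by rewrite sqrf_eq1 => /orP[/eqP//|/eqP sE]; move: sgt0; rewrite sE ltr0N1.
Qed.

Let kappa1 s := relative_sign s0 * curvature I alpha eps s.
Let kappa2 s := normal_sign eps * curvature I alpha eps s * RM_angle s.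

Lemma has_derive_on_RM_frame s : I s ->
  has_derive_on I (frame_mx t n1 (@binormal R)) s
    (mx3 [:: [:: 0; normal_sign eps * kappa1 s; kappa2 s];
             [:: - eps * kappa1 s; 0; 0];
             [:: 0; 0; 0]] *m frame_mx t n1 (@binormal R) s).
Proof.
move=> Is; rewrite mulmx_frame_mx.
have c0 : `|c s| != 0 by rewrite normr_eq0 area_speed_neq0.
have kE : - eps * curvature I alpha eps s = `|c s|.
  by rewrite curvatureE // mulrA mulrNN eps_sqr mul1r.
have k1E : - eps * kappa1 s = relative_sign s0 * `|c s| by rewrite mulrCA kE.
have nE : n s = relative_sign s0 *: n1 s + RM_angle s *: binormal s.
  by rewrite RM_fieldE // scalerA -expr2 relative_sign_sqr // scale1r subrK.
apply: has_derive_on_frame_mx.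
- have -> : normal_sign eps * kappa1 s *: n1 s + kappa2 s *: binormal s = a s.
    rewrite /kappa2 /normal_sign k1E kE comb_factor -nE normalE //.
    by rewrite scalerA divff// scale1r.
  by have [_ dt _ _] := alpha_C3; exact: derivable_onP dt Is.
- (* sigma = m c / |c|, whence sigma |c| = m c. *)
  have -> : - eps * kappa1 s = m s * c s.
    by rewrite k1E -(relative_sign_constant Is) -mulrA divfK.
  exact: has_derive_on_RM.
- exact: has_derive_on_cst.
Qed.

End Curve.

(** * The rotation minimizing frame *)

Unset Implicit Arguments.

(* A unit normal RM field is determined up to sign, hence sigma; sigma is 1
   as soon as n1 induces the same orientation as the Frenet normal n. *)
Theorem theorem8p4 (R : realType) (I : set R) (s0 : R)
    (alpha : R -> 'rV[R]_3) (eps : R) (n1 : R -> 'rV[R]_3)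
    (I_itv : is_interval I) (I_nondeg : I° !=set0) (I_s0 : I s0)
    (alpha_C3 : C3_on I alpha)
    (alpha_adm : admissible I alpha)
    (alpha_unit : unit_speed I alpha eps)
    (n1_normal : normal_field I alpha n1)
    (n1_unit : unit_field I n1)
    (n1_RM : rotation_minimizing I alpha n1) :
  let t := tangent I alpha in
  let n := normal I alpha eps in
  let b := @binormal R in
  let kappa := curvature I alpha eps in
  let tau := torsion I alpha eps in
  let eta := normal_sign eps in
  exists sigma tau0 : R,
    let theta := fun s : R => oriented_integral tau s0 s + tau0 in
    [/\ sigma = 1 \/ sigma = -1,
        (exists2 s, I s &
           same_orientation (frame_mx t n1 b s) (frame_mx t n b s)) ->
          sigma = 1,
        (forall s, I s -> n1 s = sigma *: (n s - theta s *: b s)) &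
        exists kappa1 kappa2 : R -> R,
          [/\ forall s, I s ->
                kappa1 s = sigma * kappa s /\
                kappa1 s = sigma * (kappa s * cosg (theta s)),
              forall s, I s ->
                kappa2 s = eta * kappa s * theta s /\
                kappa2 s = - eps * kappa s * sing (theta s),
              derivable_on I (frame_mx t n1 b) &
              forall s, I s ->
                derive_on I (frame_mx t n1 b) s =
                mx3 [:: [:: 0; eta * kappa1 s; kappa2 s];
                        [:: - eps * kappa1 s; 0; 0];
                        [:: 0; 0; 0]] *m frame_mx t n1 b s]].
Proof.
pose sg := relative_sign I alpha n1 s0; pose th := RM_angle I alpha eps s0 n1.
have sgsq : sg ^+ 2 = 1.
  exact: (relative_sign_sqr alpha_adm alpha_unit n1_unit n1_RM I_s0).
have thE s : I s -> oriented_integral (torsion I alpha eps) s0 s + th s0 = th s.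
  by move=> Is; rewrite /th -RM_angleE.
have frameE s : I s -> has_derive_on I _ s _ :=
  has_derive_on_RM_frame I_itv I_nondeg alpha_C3 alpha_adm alpha_unit
    I_s0 n1_unit n1_RM (s := s).
move=> t n b kappa tau eta; exists sg, (th s0) => theta; split.
- by have /eqP := sgsq; rewrite sqrf_eq1 => /orP[] /eqP ->; [left|right].
- move=> [s Is]; exact: same_orientation_relative_sign.
- by move=> s Is; rewrite /theta thE//; exact: RM_fieldE.
exists (fun s => sg * kappa s), (fun s => eta * kappa s * th s); split.
- by move=> s _; rewrite /cosg mulr1.
- by move=> s Is; rewrite /theta thE.
- by move=> s Is; apply/cvg_ex; eexists; exact: frameE.
by move=> s Is; apply: has_derive_onE => //; exact: frameE.
Qed.
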